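(* Let $n\ge2$, $0<\epsilon<1$, $0<\delta<1/2$. Any algorithm that solves the uniformity testing problem for $\ell_\infty$ distance with tolerance $\epsilon$ and failure probability $\delta$ on support size $n$ must draw at least \[ m=\frac12\,\frac{\ln\left(1+n(1-2\delta)^2\right)}{\epsilon^2n}\] samples.
   Context: A distribution on support size $n$ is a vector $A\in\mathbb{R}^n$, $A_i\ge0$, $\sum_iA_i=1$; $U_n$ is uniform; $\|V\|_\infty=\max_i|V_i|$. Uniformity testing: given $n,\epsilon,\delta$ and i.i.d. samples from an unknown distribution $A$ on $\{1,\dots,n\}$, the algorithm draws $m$ samples and must output ``uniform'' with probability at least $1-\delta$ if $A=U_n$, and ``not uniform'' with probability at least $1-\delta$ if $\|A-U_n\|_\infty\ge\epsilon$.
   Formalization: The hypothesis ε ≤ 1 − 1/n is added: for ε > 1 − 1/n no distribution is ε-far from U_n, so always answering ''uniform'' with 0 samples solves the problem while the claimed bound is positive (e.g. n=2, ε=3/4, δ=1/4). *)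

(* Defs.v *)
From mathcomp Require Import all_boot all_order all_algebra.
From mathcomp Require Import all_classical all_reals all_analysis.
Set Implicit Arguments.
Unset Strict Implicit.
Unset Printing Implicit Defensive.
Import Order.TTheory GRing.Theory Num.Theory.
Import numFieldNormedType.Exports.
Local Open Scope ring_scope.

Definition is_distr (R : realType) (T : finType) (p : T -> R) : Prop :=
  (forall x, 0 <= p x) /\ \sum_x p x = 1.

Definition uniform_vec (R : realType) (n : nat) : 'rV[R]_n :=
  const_mx n%:R^-1.

(* The l_oo norm is the library norm on 'rV[R]_n (mx_norm, cf. mx_normrE). *)
Definition linf_dist (R : realType) (n : nat) (A B : 'rV[R]_n) : R := `|A - B|.

Notation samples n m := {ffun 'I_m -> 'I_n}.

(* Law of m i.i.d. samples drawn from A. *)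
Definition iid (R : realType) (n m : nat) (A : 'rV[R]_n) (s : samples n m) : R :=
  \prod_(j < m) A ord0 (s j).

(* A (possibly randomized) algorithm drawing m samples is a Markov kernel:
   T s is the law of its output on the sample s. Output true means "uniform",
   false means "not uniform". *)
Definition is_tester (R : realType) (n m : nat)
    (T : samples n m -> bool -> R) : Prop :=
  forall s, is_distr (T s).

Definition Pr_output (R : realType) (n m : nat) (A : 'rV[R]_n)
    (T : samples n m -> bool -> R) (b : bool) : R :=
  \sum_(s : samples n m) iid A s * T s b.

Definition solves_uniformity_testing (R : realType) (n m : nat) (eps delta : R)
    (T : samples n m -> bool -> R) : Prop :=
  [/\ is_tester T,
      1 - delta <= Pr_output (uniform_vec R n) T true
    & forall A : 'rV[R]_n, is_distr (A ord0) ->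
        eps <= linf_dist A (uniform_vec R n) ->
        1 - delta <= Pr_output A T false].

(* Main.v *)
(* Le Cam's method against a random spike. For i in [n], the mixture
   A_i = (1 - h) U_n + h e_i with h = eps / (1 - 1/n) is at distance eps from
   U_n, so on the average over i of the m-sample laws of the A_i the tester
   answers "not uniform" with probability at least 1 - delta, whereas under
   U_n it does so with probability at most delta. By Cauchy-Schwarz,
   (1 - 2 delta)^2 is at most the chi-square divergence of this average from
   the law of m uniform samples. As n <A_i, A_j> is 1 + (n - 1) h^2 if i = j and
   1 - h^2 <= 1 otherwise, that divergence is at most
   ((1 + (n - 1) h^2)^m - 1) / n, and (n - 1) h^2 <= 2 n eps^2. *)
Require Import Defs.
From mathcomp Require Import all_boot all_order all_algebra ring lra.
From mathcomp Require Import all_classical all_reals all_analysis.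
Set Implicit Arguments.
Unset Strict Implicit.
Unset Printing Implicit Defensive.
Import Order.TTheory GRing.Theory Num.Theory.
Import numFieldNormedType.Exports.
Local Open Scope ring_scope.

(** Cauchy-Schwarz, with the sum of the [g i ^+ 2] bounded by [#|I|]: expand the nonnegative sum of
    the squares [(N * f i - d * g i) ^+ 2] and divide by [N]. *)
Lemma sqr_sumrM_le_card (R : realFieldType) (I : finType) (f g : I -> R) :
  (forall i, 0 <= g i <= 1) ->
  (\sum_i f i * g i) ^+ 2 <= #|I|%:R * \sum_i f i ^+ 2.
Proof.
move=> g01; have [I0|I_gt0] := posnP #|I|.
  by rewrite I0 mul0r big1 ?expr0n // => i; have := fintype0 i I0.
move defd: (\sum_i f i * g i) => d; set N : R := #|I|%:R.
have N0 : 0 < N by rewrite ltr0n.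
have g2N : \sum_i g i ^+ 2 <= N.
  rewrite /N -sum1_card natr_sum; apply: ler_sum => i _.
  by have /andP[g0 g1] := g01 i; rewrite expr_le1.
have : 0 <= \sum_i (N * f i - d * g i) ^+ 2 by apply: sumr_ge0 => i _; exact: sqr_ge0.
have -> : \sum_i (N * f i - d * g i) ^+ 2 =
    N ^+ 2 * (\sum_i f i ^+ 2) - N * d *+ 2 * d + d ^+ 2 * \sum_i g i ^+ 2.
  rewrite -{3}defd !mulr_sumr -sumrB -big_split; apply: eq_bigr => i _ /=; ring.
have : d ^+ 2 * \sum_i g i ^+ 2 <= d ^+ 2 * N by rewrite ler_wpM2l ?sqr_ge0.
set S := \sum_i f i ^+ 2 => dN ge0.
by rewrite -(ler_pM2l N0); move: dN ge0; lra.
Qed.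

Lemma sum_iidM (R : realType) (n m : nat) (A B : 'rV[R]_n) :
  \sum_(s : samples n m) iid A s * iid B s =
  (\sum_x A ord0 x * B ord0 x) ^+ m.
Proof.
under eq_bigr do rewrite -big_split.
by rewrite -(bigA_distr_bigA (fun _ x => A ord0 x * B ord0 x)) prodr_const card_ord.
Qed.

Lemma sum_iid (R : realType) (n m : nat) (A : 'rV[R]_n) :
  \sum_(s : samples n m) iid A s = (\sum_x A ord0 x) ^+ m.
Proof.
by rewrite -(bigA_distr_bigA (fun _ x => A ord0 x)) prodr_const card_ord.
Qed.

Lemma iid_uniform (R : realType) (n m : nat) (s : samples n m) :
  iid (uniform_vec R n) s = n%:R^-1 ^+ m.
Proof. by rewrite /iid; under eq_bigr do rewrite mxE; rewrite prodr_const card_ord. Qed.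

Definition spike (R : realType) (n : nat) (h : R) (i : 'I_n) : 'rV[R]_n :=
  (1 - h) *: uniform_vec R n + h *: delta_mx ord0 i.

Lemma spikeE (R : realType) (n : nat) (h : R) (i x : 'I_n) :
  spike h i ord0 x = (1 - h) / n%:R + h * (x == i)%:R.
Proof. by rewrite !mxE eqxx. Qed.

Lemma sumr_eq (R : pzSemiRingType) (I : finType) (i : I) (F : I -> R) :
  \sum_x F x * (x == i)%:R = F i.
Proof.
by rewrite (bigD1 i) //= eqxx mulr1 big1 ?addr0 // => x /negPf ->; rewrite mulr0.
Qed.

Lemma sum_spike (R : realType) (n : nat) (h : R) (i : 'I_n) :
  \sum_x spike h i ord0 x = 1.
Proof.
have n0 : n%:R != 0 :> R by rewrite pnatr_eq0 -lt0n (leq_trans _ (ltn_ord i)).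
under eq_bigr do rewrite spikeE.
rewrite big_split /= (sumr_eq i (fun=> h)) sumr_const card_ord -mulr_natr.
by field.
Qed.

Lemma is_distr_spike (R : realType) (n : nat) (h : R) (i : 'I_n) :
  0 <= h <= 1 -> is_distr (spike h i ord0).
Proof.
move=> /andP[h0 h1]; split=> [x|]; last exact: sum_spike.
by rewrite spikeE addr_ge0 ?mulr_ge0 ?invr_ge0 ?subr_ge0.
Qed.

(** Expanding only the second spike leaves the total mass of the first, which is 1, and its value at
    [j]. The factor [n%:R] turns the inner product into the correlation of the densities relative to
    the uniform law. *)
Lemma dot_spike (R : realType) (n : nat) (h : R) (i j : 'I_n) :
  n%:R * (\sum_x spike h i ord0 x * spike h j ord0 x) =
  1 - h ^+ 2 + n%:R * h ^+ 2 * (i == j)%:R.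
Proof.
have n0 : n%:R != 0 :> R by rewrite pnatr_eq0 -lt0n (leq_trans _ (ltn_ord i)).
under eq_bigr do rewrite [X in _ * X]spikeE mulrDr [X in _ + X]mulrA.
rewrite big_split /= -mulr_suml (sumr_eq j (fun x => spike h i ord0 x * h)).
by rewrite sum_spike spikeE [j == i]eq_sym; field.
Qed.

Lemma linf_dist_spike_ge (R : realType) (n : nat) (h : R) (i : 'I_n) :
  h * (1 - n%:R^-1) <= linf_dist (spike h i) (uniform_vec R n).
Proof.
rewrite /linf_dist /Num.norm/= mx_normrE.
apply: le_trans (le_bigmax _ _ (ord0, i)) => /=.
by rewrite mxE spikeE !mxE eqxx mulr1; apply: (le_trans _ (ler_norm _)); lra.
Qed.

(* [h] is the weight of the spike, so that [h (1 - 1/n) = eps]; the left-hand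
   side is the chi-square divergence of the mixture of the laws of the spiked
   samples from the uniform law, of constant density [n ^- m]. *)
Lemma chi_square_spike_le (R : realType) (n m : nat) (h : R) :
  (0 < n)%N -> 0 <= h <= 1 ->
  (n ^ m)%:R * (\sum_(s : samples n m)
     (n%:R^-1 * (\sum_i iid (spike h i) s) - n%:R^-1 ^+ m) ^+ 2)
  <= ((1 + (n%:R - 1) * h ^+ 2) ^+ m - 1) / n%:R.
Proof.
move=> n_gt0 h01.
have n0 : n%:R != 0 :> R by rewrite pnatr_eq0 -lt0n.
set v := n%:R^-1; set c := 1 + _.
pose Q (s : samples n m) := v * \sum_i iid (spike h i) s.
have Nv : n%:R ^+ m * v ^+ m = 1 :> R by rewrite -exprMn mulfV ?expr1n.
have sumQ : \sum_s Q s = 1.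
  rewrite -mulr_sumr exchange_big /=.
  under eq_bigr do rewrite sum_iid sum_spike expr1n.
  by rewrite sumr_const card_ord mulVf.
(* The square of the mixture is a double sum over pairs of spikes; each term factorizes over the [m]
   independent draws. *)
have sumQ2 : n%:R ^+ m * (\sum_s Q s ^+ 2) =
    v ^+ 2 * (\sum_(i < n) \sum_(j < n) (n%:R * \sum_x spike h i ord0 x * spike h j ord0 x) ^+ m).
  have -> : \sum_s Q s ^+ 2 =
      v ^+ 2 * \sum_(i < n) \sum_(j < n) \sum_(s : samples n m) iid (spike h i) s * iid (spike h j) s.
    under eq_bigr do rewrite /Q exprMn.
    rewrite -mulr_sumr; congr (_ * _).
    under eq_bigr do rewrite expr2 mulr_suml.
    rewrite exchange_big; apply: eq_bigr => i _.
    under eq_bigr do rewrite mulr_sumr.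
    by rewrite exchange_big.
  rewrite mulrCA; congr (_ * _); rewrite mulr_sumr; apply: eq_bigr => i _.
  by rewrite mulr_sumr; apply: eq_bigr => j _; rewrite sum_iidM exprMn.
(* Since [Q] has mass 1, the cross term gives [- 2 v ^+ m], and the [n ^ m] constant terms add back
   [v ^+ m]. *)
have -> : \sum_s (Q s - v ^+ m) ^+ 2 = \sum_s Q s ^+ 2 - v ^+ m.
  under eq_bigr do rewrite sqrrB.
  rewrite big_split sumrB /= sumr_const card_ffun !card_ord sumrMnl -mulr_suml.
  rewrite sumQ mul1r -[X in _ + X = _]mulr_natl natrX [v ^+ m ^+ 2]expr2 mulrA Nv; ring.
rewrite natrX mulrBr Nv sumQ2.
have dot_le (i j : 'I_n) : (n%:R * \sum_x spike h i ord0 x * spike h j ord0 x) ^+ m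
    <= 1 + (c ^+ m - 1) * (j == i)%:R.
  rewrite dot_spike eq_sym; case: eqP => _; rewrite ?mulr1 ?mulr0 ?addr0.
    have -> : 1 - h ^+ 2 + n%:R * h ^+ 2 = c by rewrite /c; ring.
    by rewrite addrC subrK.
  by move: h01 => /andP[h0 h1]; rewrite exprn_ile1 ?subr_ge0 ?expr_le1 // gerBl sqr_ge0.
have dots_le : \sum_(i < n) \sum_(j < n) (n%:R * \sum_x spike h i ord0 x * spike h j ord0 x) ^+ m
    <= n%:R * (n%:R + (c ^+ m - 1)).
  rewrite mulr_natl -[in leRHS](card_ord n) -sumr_const; apply: ler_sum => i _.
  apply: le_trans (ler_sum _ (fun j _ => dot_le i j)) _.
  by rewrite big_split /= (sumr_eq i (fun=> c ^+ m - 1)) sumr_const card_ord.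
apply: le_trans (lerB (ler_wpM2l (sqr_ge0 v) dots_le) (lexx 1)) _.
by rewrite le_eqVlt; apply/orP; left; apply/eqP; rewrite /v; field.
Qed.

Theorem theorem14 (R : realType) (n m : nat) (eps delta : R)
    (T : samples n m -> bool -> R)
    (hn : (2 <= n)%N) (heps : 0 < eps < 1) (hdelta : 0 < delta < 1 / 2)
    (* otherwise no distribution on 'I_n is eps-far from uniform *)
    (hfar : eps <= 1 - n%:R^-1)
    (hT : solves_uniformity_testing eps delta T) :
  1 / 2 * (ln (1 + n%:R * (1 - 2 * delta) ^+ 2) / (eps ^+ 2 * n%:R)) <= m%:R.
Proof.
case: hT => testerT unifT farT.
have n_gt0 : (0 < n)%N by apply: leq_trans hn.
have n2 : 2 <= n%:R :> R by rewrite (ler_nat R 2).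
have nR0 : 0 < n%:R :> R by rewrite ltr0n.
have n0 : n%:R != 0 :> R by rewrite gt_eqF.
case/andP: heps => eps0 eps1; case/andP: hdelta => delta0 delta1.
pose h := eps / (1 - n%:R^-1).
have w0 : 0 < 1 - n%:R^-1 :> R by apply: lt_le_trans hfar.
have h01 : 0 <= h <= 1 by rewrite /h ler_pdivrMr // mul1r hfar divr_ge0 // ltW.
pose f (s : samples n m) := n%:R^-1 * (\sum_i iid (spike h i) s) - n%:R^-1 ^+ m.
(* The rejection probability, randomized or not, is the weight [g] of the Cauchy-Schwarz step. *)
have T01 s : 0 <= T s false <= 1.
  have [T0 T1] := testerT s; rewrite T0 /= -T1 big_bool /= lerDr; exact: T0.
have gap : 1 - 2 * delta <= \sum_s f s * T s false.
  under eq_bigr do rewrite mulrBl.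
  rewrite sumrB.
  have -> : \sum_s n%:R^-1 * (\sum_i iid (spike h i) s) * T s false =
      n%:R^-1 * \sum_i Pr_output (spike h i) T false.
    rewrite exchange_big mulr_sumr; apply: eq_bigr => s _ /=.
    by rewrite -mulrA mulr_suml.
  have mix : 1 - delta <= n%:R^-1 * \sum_i Pr_output (spike h i) T false.
    rewrite ler_pdivlMl // mulr_natl -[in leLHS](card_ord n) -sumr_const.
    apply: ler_sum => i _; apply: farT; first exact: is_distr_spike.
    apply: le_trans (linf_dist_spike_ge h i).
    by rewrite /h divfK ?gt_eqF.
  have unif : \sum_s n%:R^-1 ^+ m * T s false = 1 - Pr_output (uniform_vec R n) T true.
    have tot : \sum_(s : samples n m) n%:R^-1 ^+ m = 1 :> R.
      by rewrite sumr_const card_ffun !card_ord -[LHS]mulr_natl natrX -exprMn mulfV ?expr1n.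
    rewrite -[X in X - _]tot -sumrB; apply: eq_bigr => s _; rewrite iid_uniform.
    have [_] := testerT s; rewrite big_bool /= => /(canRL (addKr _)) ->; ring.
  by move: mix unifT; rewrite unif; lra.
have key : 1 + n%:R * (1 - 2 * delta) ^+ 2 <= (1 + (n%:R - 1) * h ^+ 2) ^+ m.
  have := chi_square_spike_le m n_gt0 h01; have := sqr_sumrM_le_card f T01.
  rewrite card_ffun !card_ord => CS chi; have {CS chi} := le_trans CS chi.
  rewrite ler_pdivlMr // mulrC => bd; rewrite addrC -lerBrDr; apply: le_trans bd.
  (* Squaring [gap] keeps its direction because [delta < 1 / 2]. *)
  by rewrite ler_pM2l // lerXn2r ?nnegrE //; lra.
(* The factor 1/2 of the final bound comes from here: [n / (n - 1) <= 2] for [n >= 2]. *)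
have hn_le : (n%:R - 1) * h ^+ 2 <= 2 * n%:R * eps ^+ 2.
  have n1 : n%:R - 1 != 0 :> R by apply: lt0r_neq0; lra.
  have -> : (n%:R - 1) * h ^+ 2 = (n%:R / (n%:R - 1)) * (n%:R * eps ^+ 2).
    by rewrite /h; field; rewrite n0 n1.
  rewrite -[leRHS]mulrA ler_wpM2r ?(mulr_ge0 _ (sqr_ge0 _)) //.
  by rewrite ler_pdivrMr; lra.
(* Take logarithms in [key], after bounding the base by [1 + x <= expR x] at
   [x = 2 * n%:R * eps ^+ 2]. *)
have : ln (1 + n%:R * (1 - 2 * delta) ^+ 2) <= m%:R * (2 * n%:R * eps ^+ 2).
  have pos : 0 < 1 + n%:R * (1 - 2 * delta) ^+ 2 by rewrite ltr_wpDr ?(mulr_ge0 _ (sqr_ge0 _)).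
  rewrite -[leRHS]expRK ler_ln ?posrE ?expR_gt0 //; apply: le_trans key _.
  rewrite expRM_natl lerXn2r ?nnegrE ?expR_ge0 //.
    by rewrite addr_ge0 ?(mulr_ge0 _ (sqr_ge0 _)) //; lra.
  by apply: le_trans (expR_ge1Dx _); rewrite lerD2l.
have e0 : 0 < eps ^+ 2 * n%:R by rewrite mulr_gt0 ?exprn_gt0.
move=> bd; rewrite mulrA ler_pdivrMr //; move: bd; lra.
Qed.
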